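(* Let $G_1$ and $G_2$ be groups, let $\mathcal{C}_1=\{M_1,\dots,M_m\}$ be an irredundant $m$-cover for $G_1$, and let $\mathcal{C}_2=\{N_1,\dots,N_n\}$ be an irredundant $n$-cover for $G_2$. Suppose that $M_1$ is a normal subgroup of $G_1$ and $N_1$ is a normal subgroup of $G_2$. Let $a\in G_1\setminus M_1$ and $b\in G_2\setminus N_1$ be such that, for some prime number $p$, the coset $M_1a$ (as an element of $G_1/M_1$) and the coset $N_1b$ (as an element of $G_2/N_1$) both have order $p$. Let $(M_1\times N_1)\langle (a,b)\rangle$ denote the subgroup of $G_1\times G_2$ generated by $M_1\times N_1$ and the element $(a,b)$. Then $$\mathcal{C}=\{(M_1\times N_1)\langle (a,b)\rangle,\ M_i\times G_2,\ G_1\times N_j \;|\; i=2,\dots,m;\ j=2,\dots,n\}$$ is an irredundant $(n+m-1)$-cover for $G_1\times G_2$, and the intersection of all members of $\mathcal{C}$ is $D_1\times D_2$, where $D_1=\bigcap_{i=1}^m M_i$ and $D_2=\bigcap_{j=1}^n N_j$. In particular, if both $\mathcal{C}_1$ and $\mathcal{C}_2$ are maximal covers, then $\mathcal{C}$ is a maximal cover for $G_1\times G_2$.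
   Context: Let $G$ be a group (not assumed finite). A set $\mathcal{S}$ of proper subgroups of $G$ is called a cover for $G$ if $G=\bigcup_{H\in\mathcal{S}}H$. A cover $\mathcal{S}$ is irredundant if no proper sub-collection of $\mathcal{S}$ is a cover for $G$. A cover $\mathcal{S}$ is an $n$-cover if $|\mathcal{S}|=n$ (so the members listed are pairwise distinct), where $n$ is a positive integer. A cover $\mathcal{S}$ is maximal if each member of $\mathcal{S}$ is a maximal subgroup of $G$. *)

(* Defs.v *)
From mathcomp Require Import all_boot.
From mathcomp Require Import all_classical.
Set Implicit Arguments.
Unset Strict Implicit.
Unset Printing Implicit Defensive.

Local Open Scope classical_set_scope.
Local Open Scope card_scope.
Local Open Scope group_scope.

(* Subgroups of a possibly infinite group are classical sets. *)
Definition is_subgroup (G : groupType) (H : set G) : Prop :=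
  group_closed [in H].

Definition proper_subgroup (G : groupType) (H : set G) : Prop :=
  is_subgroup H /\ H <> setT.

Definition normal_subgroup (G : groupType) (H : set G) : Prop :=
  is_subgroup H /\ forall g x : G, H x -> H (x ^ g).

Definition maximal_subgroup (G : groupType) (H : set G) : Prop :=
  proper_subgroup H /\
  forall K : set G, proper_subgroup K -> H `<=` K -> K = H.

Definition subgroup_generated (G : groupType) (A : set G) : set G :=
  smallest (@is_subgroup G) A.

Definition right_coset (G : groupType) (M : set G) (a : G) : set G :=
  [set x * a | x in M].

(* For M normal in G, the elements of G/M are the cosets of M, multiplied by
   setwise product, with identity M: [quotient_exp M A k] is the k-th power of
   A in G/M, and [has_order_in_quotient M A k] says that A has finite order k
   in G/M. *)
Definition setwise_mul (G : groupType) (A B : set G) : set G :=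
  [set x * y | x in A & y in B].

Definition quotient_exp (G : groupType) (M A : set G) (k : nat) : set G :=
  iter k (setwise_mul A) M.

Definition has_order_in_quotient (G : groupType) (M A : set G) (k : nat)
    : Prop :=
  [/\ (0 < k)%N, quotient_exp M A k = M &
      forall j : nat, (0 < j < k)%N -> quotient_exp M A j <> M].

Definition is_cover (G : groupType) (S : set (set G)) : Prop :=
  (forall H, S H -> proper_subgroup H) /\ \bigcup_(H in S) H = setT.

Definition irredundant_cover (G : groupType) (S : set (set G)) : Prop :=
  is_cover S /\ forall T : set (set G), T `<` S -> ~ is_cover T.

Definition is_ncover (G : groupType) (n : nat) (S : set (set G)) : Prop :=
  [/\ (0 < n)%N, is_cover S & S #= `I_n].

Definition irredundant_ncover (G : groupType) (n : nat) (S : set (set G))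
    : Prop :=
  irredundant_cover S /\ is_ncover n S.

Definition maximal_cover (G : groupType) (S : set (set G)) : Prop :=
  is_cover S /\ forall H, S H -> maximal_subgroup H.

(* Main.v *)
(* Irredundance of a family of n distinct subgroups means that each member has a
   private point, lying in no other member. Write K for the subgroup generated
   by M_1 x N_1 and (a, b). Every (x, y) in K has (x a^k, y b^k) in M_1 x N_1 for
   some k, and a^k is in M_1 iff p | k iff b^k is in N_1; hence on K the
   conditions x in M_1 and y in N_1 are equivalent. So if x_i, y_j are private
   points of M_i, N_j, then (x_1, y_1), (x_i, y_1), (x_1, y_j) are private points
   of K, M_i x G_2, G_1 x N_j. *)
Require Import Defs.
From mathcomp Require Import all_boot finmap zify.
From mathcomp Require Import all_classical.
Set Implicit Arguments.
Unset Strict Implicit.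
Unset Printing Implicit Defensive.

Local Open Scope classical_set_scope.
Local Open Scope card_scope.
Local Open Scope group_scope.

(** Two indices with the same image would make the image of the finite set [D] strictly smaller.
    This turns the count in an [n]-cover into distinctness of its listed members. *)
Lemma card_image_inj (I T : choiceType) (f : I -> T) (D : set I) :
  finite_set D -> f @` D #= D -> {in D &, injective f}.
Proof.
move=> finD /(fcard_eq (finite_image f finD) finD)/eqP.
rewrite fset_set_image// => /card_in_imfsetP finj i j iD jD.
by apply: finj; rewrite in_fset_set.
Qed.

(** * Closure properties of subgroups given as classical sets *)

Section Subgroup.
Variables (G : groupType) (H : set G).
Hypothesis sgH : is_subgroup H.

Lemma subgroup1 : H 1.
Proof. by case: sgH => /set_mem. Qed.

Lemma subgroupV x : H x -> H x^-1.
Proof. by move/mem_set=> Hx; apply/set_mem; exact: group_closedV sgH _ Hx. Qed.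

Lemma subgroupM x y : H x -> H y -> H (x * y).
Proof.
by move=> /mem_set Hx /mem_set Hy; apply/set_mem; exact: group_closedM sgH _ _ Hx Hy.
Qed.

Lemma subgroupMr x y : H x -> H (x * y) <-> H y.
Proof.
move=> Hx; split=> [Hxy|]; last exact: subgroupM.
by rewrite -(mulKg x y); apply: subgroupM Hxy; exact: subgroupV.
Qed.

Lemma subgroupMl x y : H y -> H (x * y) <-> H x.
Proof.
move=> Hy; split=> [Hxy|Hx]; last exact: subgroupM.
by rewrite -(mulgK y x); apply: subgroupM Hxy _; exact: subgroupV.
Qed.

Lemma subgroupX x n : H x -> H (x ^+ n).
Proof.
move=> Hx; elim: n => [|n IHn]; first exact: subgroup1.
by rewrite expgS; exact: subgroupM.
Qed.

End Subgroup.

Lemma subgroupP (G : groupType) (H : set G) :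
  H 1 -> (forall x y, H x -> H y -> H (x * y)) -> (forall x, H x -> H x^-1) ->
  is_subgroup H.
Proof.
move=> H1 HM HV; split; first exact: mem_set.
by move=> x y /set_mem Hx /set_mem Hy; apply/mem_set/HM => //; exact: HV.
Qed.

(** A private point of [F i] is one missed by the family without [F i]. Conversely, private points
    force any subcover to keep every [F i], and they also separate the members, which gives the
    count. *)
Lemma irredundant_ncoverP (G : groupType) (I : choiceType) (D : set I) n
    (F : I -> set G) : D #= `I_n ->
  irredundant_ncover n (F @` D) <->
  [/\ (0 < n)%N, forall i, D i -> proper_subgroup (F i),
      forall x, exists2 i, D i & F i x &
      forall i, D i -> exists2 x, F i x & forall j, D j -> F j x -> j = i].
Proof.
move=> Dn; have finD : finite_set D by apply/finite_setP; exists n.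
split=> [[[_ irr] [n0 [propF covF] FDn]]|[n0 propF covF privF]].
  have Finj : {in D &, injective F}.
    by apply: card_image_inj => //; rewrite (card_eqr Dn).
  split=> // [i Di|x|i Di]; first by apply: propF; exists i.
    have [_ [i Di <-] Fix] : (\bigcup_(H in F @` D) H) x by rewrite covF.
    by exists i.
  (* Injectivity is what makes this inclusion strict: [F i] is not restored by another index. *)
  have DiD : F @` (D `\ i) `<` F @` D.
    split=> [|/(_ (F i))]; first by apply: image_subset => j [].
    case=> [|j [Dj ji] /Finj]; first by exists i.
    by rewrite !inE => /(_ Dj Di) /ji.
  have [x xF] : exists x, forall j, D j -> j <> i -> ~ F j x.
    apply: contrapT => nx; apply: (irr _ DiD); split.
      by move=> _ [j [Dj _] <-]; apply: propF; exists j.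
    apply/seteqP; split=> // x _; apply: contrapT => xF; apply: nx.
    by exists x => j Dj ji Fjx; apply: xF; exists (F j) => //; exists j.
  exists x => [|j Dj Fjx]; last by apply: contrapT => ji; exact: xF Fjx.
  have [_ [j Dj <-] Fjx] : (\bigcup_(H in F @` D) H) x by rewrite covF.
  by have [<-//|/eqP ji] := eqVneq j i; case: (xF j Dj ji).
have cF : is_cover (F @` D).
  split=> [_ [i Di <-]|]; first exact: propF.
  apply/seteqP; split=> // x _; have [i Di Fix] := covF x.
  by exists (F i) => //; exists i.
split; split=> //.
  move=> T [TD DT] [_ covT]; apply: DT => _ [i Di <-].
  have [x Fix xi] := privF i Di.
  have [H TH Hx] : (\bigcup_(H in T) H) x by rewrite covT.
  have [j Dj jH] := TD H TH.
  by rewrite -(xi j Dj) jH.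
rewrite -(card_eqr Dn); apply: inj_card_eq => i j; rewrite !inE => Di Dj Fij.
by have [x Fix xj] := privF j Dj; apply: xj => //; rewrite Fij.
Qed.

(** * Cosets of a normal subgroup and orders in the quotient *)

Section NormalSubgroup.
Variables (G : groupType) (M : set G) (a : G).
Hypothesis nM : normal_subgroup M.
Let sgM : is_subgroup M := nM.1.

Lemma normal_subgroupC x y : M (x * y) -> M (y * x).
Proof. by move=> /(nM.2 x); rewrite conjgE mulgA mulKg. Qed.

Lemma right_cosetE x : right_coset M a x <-> M (x / a).
Proof.
split=> [[y My <-]|Mxa]; first by rewrite mulgK.
by exists (x / a) => //; rewrite mulgVK.
Qed.

Lemma right_coset_id : right_coset M a = M <-> M a.
Proof.
split=> [<-|Ma]; first by exists 1; rewrite ?mul1g//; exact: subgroup1.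
apply/seteqP; split=> x; rewrite right_cosetE => Mx.
  by apply/(subgroupMl sgM _ (subgroupV sgM Ma)).
by apply/(subgroupMl sgM _ (subgroupV sgM Ma)).
Qed.

End NormalSubgroup.

Lemma quotient_exp_coset (G : groupType) (M : set G) (a : G) k :
  normal_subgroup M ->
  quotient_exp M (right_coset M a) k = right_coset M (a ^+ k).
Proof.
move=> nM; have sgM := nM.1; elim: k => [|k IHk].
  by rewrite expg0; apply: esym; apply/(right_coset_id _ nM); exact: subgroup1.
rewrite [quotient_exp _ _ _]/= -/(quotient_exp _ _ _) IHk expgS.
apply/seteqP; split=> [_ [_ [u Mu <-] [_ [v Mv <-] <-]]|_ [u Mu <-]].
  (* Normality moves [a] past [v]: [a * v = v ^ a^-1 * a]. *)
  exists (u * v ^ a^-1); first by apply: subgroupM => //; exact: nM.2.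
  by rewrite conjgE invgK !mulgA mulgVK.
exists (u * a); first by exists u.
exists (a ^+ k); last by rewrite mulgA.
by exists 1; rewrite ?mul1g//; exact: subgroup1.
Qed.

(** Divide [k] by [p]: minimality of the order excludes a nonzero remainder. *)
Lemma has_order_in_quotientE (G : groupType) (M : set G) (a : G) p k :
    normal_subgroup M -> has_order_in_quotient M (right_coset M a) p ->
  M (a ^+ k) <-> (p %| k)%N.
Proof.
move=> nM [p0 ap aj]; have sgM := nM.1.
have {ap}Map : M (a ^+ p) by apply/(right_coset_id _ nM); rewrite -quotient_exp_coset.
have MpX q : M (a ^+ (q * p)) by rewrite mulnC expgnA; exact: subgroupX.
rewrite {1}(divn_eq k p) expgnDr (subgroupMr sgM) //; split=> [Mk|/eqP->].
  apply: contrapT => /negP pk; apply: (aj (k %% p)%N).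
    by rewrite lt0n ltn_mod p0 andbT.
  by rewrite quotient_exp_coset//; apply/(right_coset_id _ nM).
by rewrite expg0; exact: subgroup1.
Qed.

Lemma is_subgroup_generated (G : groupType) (A : set G) :
  is_subgroup (subgroup_generated A).
Proof.
apply: subgroupP => [H [sgH _]|x y Ax Ay H HA|x Ax H HA].
- exact: (subgroup1 sgH).
- exact: (subgroupM HA.1 (Ax _ HA) (Ay _ HA)).
- exact: (subgroupV HA.1 (Ax _ HA)).
Qed.

(** * The subgroup generated by [M x N] and [(a, b)] *)

Section Diagonal.
Variables (G1 G2 : groupType) (M : set G1) (N : set G2) (a : G1) (b : G2).
Local Notation K := (subgroup_generated ((M `*` N) `|` [set (a, b)])).

Lemma diagonal_gen : K (a, b).
Proof. by apply: sub_gen_smallest; right. Qed.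

Lemma diagonal_setX x y : M x -> N y -> K (x, y).
Proof. by move=> Mx Ny; apply: sub_gen_smallest; left. Qed.

Variable p : nat.
Hypotheses (nM : normal_subgroup M) (nN : normal_subgroup N).
Hypothesis hap : has_order_in_quotient M (right_coset M a) p.
Hypothesis hbp : has_order_in_quotient N (right_coset N b) p.
Let sgM : is_subgroup M := nM.1.
Let sgN : is_subgroup N := nN.1.

(** The pairs that one common exponent brings into [M x N] form a subgroup containing the
    generators, so they include all of [K]. *)
Lemma diagonalP x y : K (x, y) -> exists k, M (x * a ^+ k) /\ N (y * b ^+ k).
Proof.
have p0 : (0 < p)%N by case: hap.
move: x y; suff KS : K `<=` [set z | exists k, M (z.1 * a ^+ k) /\ N (z.2 * b ^+ k)].
  by move=> x y /KS.
apply: smallest_sub; last first.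
  move=> [x y] [[/= Mx Ny]|[-> ->]]; first by exists 0%N; rewrite !expg0 !mulg1.
  (* Exponents are natural numbers, so [p.-1] plays the role of -1: [a ^+ p] is in [M] and [b ^+ p]
     in [N]. *)
  exists p.-1; rewrite /= -!expgS prednK//.
  by split; [apply/(has_order_in_quotientE _ nM hap)
    |apply/(has_order_in_quotientE _ nN hbp)].
have mulP (G : groupType) (L : set G) (c u v : G) k l : normal_subgroup L ->
    L (u * c ^+ k) -> L (v * c ^+ l) -> L (u * v * c ^+ (l + k)).
  move=> nL Lu Lv; rewrite expgnDr -mulgA (mulgA v); apply: (normal_subgroupC nL).
  rewrite -(mulgA (v * _)); apply: (subgroupM nL.1 Lv); exact: normal_subgroupC.
have invP (G : groupType) (L : set G) (c u : G) k : normal_subgroup L ->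
    L (c ^+ (k * p)) -> L (u * c ^+ k) -> L (u^-1 * c ^+ (k * p - k)).
  move=> nL Lkp Lu; apply: (normal_subgroupC nL).
  rewrite expgnFr ?leq_pmulr// -mulgA -invgM.
  exact: (subgroupM nL.1 Lkp (subgroupV nL.1 Lu)).
apply: subgroupP => [|[x y] [x' y'] [k [/= Mx Ny]] [l [/= Mx' Ny']]|[x y] [k [/= Mx Ny]]].
- by exists 0%N; rewrite !expg0 !mulg1; split; exact: subgroup1.
- by exists (l + k)%N; split; exact: mulP.
(* This exponent is a natural number congruent to [-k] modulo [p]. *)
- exists (k * p - k)%N; split; apply: invP => //.
    by apply/(has_order_in_quotientE _ nM hap); exact: dvdn_mull.
  by apply/(has_order_in_quotientE _ nN hbp); exact: dvdn_mull.
Qed.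

Lemma diagonal_fst x y : K (x, y) -> N y -> M x.
Proof.
move=> /diagonalP[k [Mx Nyk]] Ny.
have : N (b ^+ k) by apply/(subgroupMr sgN _ Ny).
move=> /(has_order_in_quotientE _ nN hbp)/(has_order_in_quotientE _ nM hap) Mk.
by apply/(subgroupMl sgM _ Mk).
Qed.

Lemma diagonal_snd x y : K (x, y) -> M x -> N y.
Proof.
move=> /diagonalP[k [Mxk Nyk]] Mx.
have : M (a ^+ k) by apply/(subgroupMr sgM _ Mx).
move=> /(has_order_in_quotientE _ nM hap)/(has_order_in_quotientE _ nN hbp) Nk.
by apply/(subgroupMl sgN _ Nk).
Qed.

Let sgK : is_subgroup K := @is_subgroup_generated _ _.

(** The point [(a, 1)] is outside [K], its second coordinate being in [N] and its first not in
    [M]. *)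
Lemma diagonal_proper : ~ M a -> proper_subgroup K.
Proof.
move=> Ma; split=> // KT; apply/Ma/(@diagonal_fst a 1); first by rewrite KT.
exact: subgroup1.
Qed.

(* If [L] is proper and contains [K], its trace on the second factor contains
   [N] and not [b], hence equals [N]; the first projection of [K] is onto, so
   each point of [L] is a point of [K] times a point of the trace. *)
Lemma diagonal_maximal :
  maximal_subgroup M -> maximal_subgroup N -> ~ M a -> maximal_subgroup K.
Proof.
move=> [_ maxM] [_ maxN] Ma; split=> [|L [sgL LT] KL]; first exact: diagonal_proper.
have projK x : exists y, K (x, y).
  (* The projection [P] contains [M] and also [a], so maximality of [M] leaves only the whole
     group. *)
  pose P := [set x | exists y, K (x, y)].
  suff PT : P = setT by have : P x by rewrite PT.
  apply: contrapT => PT; have PM : P = M; last first.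
    by apply: Ma; rewrite -PM; exists b; exact: diagonal_gen.
  apply: maxM => [|z Mz]; last by exists 1; apply: diagonal_setX => //; exact: subgroup1.
  split=> //; apply: subgroupP => [|u v [u' Ku] [v' Kv]|u [u' Ku]].
  - by exists 1; exact: (subgroup1 sgK).
  - by exists (u' * v'); exact: (subgroupM sgK Ku Kv).
  - by exists u'^-1; exact: (subgroupV sgK Ku).
pose Q := [set y | L (1, y)].
have LE x y z : K (x, z) -> L (x, y) <-> Q (z^-1 * y).
  move=> /KL Lxz; rewrite -[Q _](subgroupMr sgL _ Lxz).
  have -> : (x, z) * (1, z^-1 * y) = (x * 1, z * (z^-1 * y)) by [].
  by rewrite mulg1 mulVKg.
have QN : Q = N.
  apply: maxN => [|y Ny]; last exact: KL (diagonal_setX (subgroup1 sgM) Ny).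
  split.
    apply: subgroupP => [|u v Lu Lv|u Lu].
    - exact: (subgroup1 sgL).
    - by have := subgroupM sgL Lu Lv; rewrite /Q/= -[(1, u) * _]/(1 * 1, _) mulg1.
    - by have := subgroupV sgL Lu; rewrite /Q/= -[(1, u)^-1]/(1^-1, _) invg1.
  (* If the trace [Q] were everything, [LE] and surjectivity of the projection would make [L]
     everything. *)
  move=> QT; apply: LT; apply/seteqP; split=> // -[x y] _.
  by have [z /LE->] := projK x; rewrite QT.
apply/seteqP; split=> // -[x y]; have [z Kxz] := projK x.
rewrite (LE _ _ _ Kxz) QN => Nzy.
have := subgroupM sgK Kxz (diagonal_setX (subgroup1 sgM) Nzy).
by rewrite -[(x, z) * _]/(x * 1, z * (z^-1 * y)) mulg1 mulVKg.
Qed.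

End Diagonal.

(** * Products of a subgroup with a whole factor *)

Section ProductSubgroup.
Variables G1 G2 : groupType.

Lemma setXT_proper (M : set G1) :
  proper_subgroup M -> proper_subgroup (M `*` [set: G2]).
Proof.
move=> [sgM MT]; split.
  apply: subgroupP => [|x y [Mx _] [My _]|x [Mx _]]; split=> //.
  - exact: (subgroup1 sgM).
  - exact: (subgroupM sgM Mx My).
  - exact: (subgroupV sgM Mx).
move=> E; apply: MT; apply/seteqP; split=> // x _.
by have [] : (M `*` [set: G2]) (x, 1) by rewrite E.
Qed.

Lemma setTX_proper (N : set G2) :
  proper_subgroup N -> proper_subgroup ([set: G1] `*` N).
Proof.
move=> [sgN NT]; split.
  apply: subgroupP => [|x y [_ Nx] [_ Ny]|x [_ Nx]]; split=> //.
  - exact: (subgroup1 sgN).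
  - exact: (subgroupM sgN Nx Ny).
  - exact: (subgroupV sgN Nx).
move=> E; apply: NT; apply/seteqP; split=> // y _.
by have [] : ([set: G1] `*` N) (1, y) by rewrite E.
Qed.

(** A subgroup [L] above [M x G2] contains [1 x G2], so membership in [L] depends on the first
    coordinate only, and maximality of [M] applies to the set [P] of these coordinates. *)
Lemma setXT_maximal (M : set G1) :
  maximal_subgroup M -> maximal_subgroup (M `*` [set: G2]).
Proof.
move=> [propM maxM]; split=> [|L [sgL LT] ML]; first exact: setXT_proper.
have sgM := propM.1; pose P := [set x | L (x, 1)].
have LE x y : L (x, y) <-> P x.
  have L1y : L (1, y) by apply: ML; split=> //; exact: subgroup1.
  rewrite -[P x](subgroupMl sgL _ L1y).
  by rewrite -[(x, 1) * _]/(x * 1, 1 * y) mulg1 mul1g.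
have -> : M = P.
  apply/esym/maxM => [|x Mx]; last by apply: ML.
  split.
    apply: subgroupP => [|u v Lu Lv|u Lu].
    - exact: (subgroup1 sgL).
    - by have := subgroupM sgL Lu Lv; rewrite -[(u, 1) * _]/(u * v, 1 * 1) => /LE.
    - by have := subgroupV sgL Lu; rewrite -[(u, 1)^-1]/(u^-1, 1^-1) => /LE.
  by move=> PT; apply: LT; apply/seteqP; split=> // -[x y] _; apply/LE; rewrite PT.
by apply/seteqP; split=> -[x y]; [move/LE|case=> Px _; apply/LE].
Qed.

Lemma setTX_maximal (N : set G2) :
  maximal_subgroup N -> maximal_subgroup ([set: G1] `*` N).
Proof.
move=> [propN maxN]; split=> [|L [sgL LT] NL]; first exact: setTX_proper.
have sgN := propN.1; pose P := [set y | L (1, y)].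
have LE x y : L (x, y) <-> P y.
  have Lx1 : L (x, 1) by apply: NL; split=> //; exact: subgroup1.
  rewrite -[P y](subgroupMr sgL _ Lx1).
  by rewrite -[(x, 1) * _]/(x * 1, 1 * y) mulg1 mul1g.
have -> : N = P.
  apply/esym/maxN => [|y Ny]; last by apply: NL.
  split.
    apply: subgroupP => [|u v Lu Lv|u Lu].
    - exact: (subgroup1 sgL).
    - by have := subgroupM sgL Lu Lv; rewrite -[(1, u) * _]/(1 * 1, u * v) => /LE.
    - by have := subgroupV sgL Lu; rewrite -[(1, u)^-1]/(1^-1, u^-1) => /LE.
  by move=> PT; apply: LT; apply/seteqP; split=> // -[x y] _; apply/LE; rewrite PT.
by apply/seteqP; split=> -[x y]; [move/LE|case=> _ Py; apply/LE].
Qed.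

End ProductSubgroup.

(* If [x] lies in all the other members, then [x * x0] lies in none of them, so
   it lies in [F i0]. *)
Lemma bigcap_cover_delete (G : groupType) (I : eqType) (D : set I)
    (F : I -> set G) (i0 : I) (x0 : G) :
  (forall i, D i -> is_subgroup (F i)) ->
  (forall x, exists2 i, D i & F i x) ->
  D i0 -> F i0 x0 -> (forall i, D i -> F i x0 -> i = i0) ->
  forall x, (forall i, D i -> i <> i0 -> F i x) -> F i0 x.
Proof.
move=> sgF covF Di0 Fx0 x0i x Fx; have [i Di Fi] := covF (x * x0).
suff ii0 : i = i0 by move: Fi; rewrite ii0 => /(subgroupMl (sgF _ Di0) _ Fx0).
apply: contrapT => ii0; apply/ii0/x0i => //.
exact/(subgroupMr (sgF _ Di) _ (Fx _ Di ii0)).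
Qed.

(** * The cover of the direct product *)

Theorem theorem1p1 (G1 G2 : groupType) (m n : nat)
    (M : nat -> set G1) (N : nat -> set G2)
    (hC1 : irredundant_ncover m [set M i | i in [set i | (1 <= i <= m)%N]])
    (hC2 : irredundant_ncover n [set N j | j in [set j | (1 <= j <= n)%N]])
    (hM1 : normal_subgroup (M 1%N)) (hN1 : normal_subgroup (N 1%N))
    (a : G1) (b : G2) (ha : ~ M 1%N a) (hb : ~ N 1%N b)
    (p : nat) (hp : prime p)
    (hap : has_order_in_quotient (M 1%N) (right_coset (M 1%N) a) p)
    (hbp : has_order_in_quotient (N 1%N) (right_coset (N 1%N) b) p) :
  let C1 : set (set G1) := [set M i | i in [set i | (1 <= i <= m)%N]] in
  let C2 : set (set G2) := [set N j | j in [set j | (1 <= j <= n)%N]] in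
  let C : set (set (G1 * G2)%type) :=
    [set subgroup_generated ((M 1%N `*` N 1%N) `|` [set (a, b)])]
    `|` [set M i `*` [set: G2] | i in [set i | (2 <= i <= m)%N]]
    `|` [set [set: G1] `*` N j | j in [set j | (2 <= j <= n)%N]] in
  [/\ irredundant_ncover (n + m - 1)%N C,
      \bigcap_(H in C) H =
        (\bigcap_(i in [set i | (1 <= i <= m)%N]) M i)
        `*` (\bigcap_(j in [set j | (1 <= j <= n)%N]) N j)
    & maximal_cover C1 -> maximal_cover C2 -> maximal_cover C].
Proof.
move=> C1 C2 C.
have DE k : [set i | (1 <= i <= k)%N] #= `I_k.
  have -> : [set i | (1 <= i <= k)%N] = succn @` `I_k.
    by apply/seteqP; split=> [[//|i] ik|_ [i ik <-]] //; exists i.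
  by apply: inj_card_eq => i j _ _ [].
have [m0 propM covM privM] := (irredundant_ncoverP M (DE m)).1 hC1.
have [n0 propN covN privN] := (irredundant_ncoverP N (DE n)).1 hC2.
have D1m : (1 <= 1 <= m)%N by [].
have D1n : (1 <= 1 <= n)%N by [].
have [x1 Mx1 x1P] := privM 1%N D1m.
have [y1 Ny1 y1P] := privN 1%N D1n.
set K := subgroup_generated _ in C *.
(* One enumeration of [C]: index 0 is [K], indices 1 to [m - 1] give [M 2] to [M m], and indices [m]
   to [n + m - 2] give [N 2] to [N n]. *)
pose h k := if k is 0 then K else
  if (k < m)%N then M k.+1 `*` [set: G2] else [set: G1] `*` N (k - m).+2.
have CE : C = h @` `I_(n + m - 1).
  apply/seteqP; split.
    move=> _ [[->|[[//|[//|i]] /= im <-]]|[[//|[//|j]] /= jn <-]].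
    - by exists 0%N => //=; lia.
    - by exists i.+1 => /=; [lia|rewrite im].
    - exists (m + j)%N => /=; first lia.
      (* Since [m] is positive, the index can be shown as a successor, which lets [h] reduce past
         its zero branch. *)
      have -> : h (m + j)%N = h (m + j).-1.+1 by congr h; lia.
      by rewrite /h ifF; [congr (_ `*` N _); lia|lia].
  move=> _ [[|k] /= kmn <-]; first by left; left.
  case: ifPn => km; first by left; right; exists k.+2 => //=; lia.
  by right; exists (k.+1 - m).+2 => //=; lia.
have propK : proper_subgroup K by exact: diagonal_proper hap hbp _.
have irrC : irredundant_ncover (n + m - 1) C.
  rewrite CE; apply/irredundant_ncoverP => //; split.
  - lia.
  - move=> [//|k] /= kmn; case: ifPn => km.
      by apply/setXT_proper/propM => /=; lia.
    by apply/setTX_proper/propN => /=; lia.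
  - move=> [x y]; suff [H] : exists2 H, C H & H (x, y).
      by rewrite CE => -[k kmn <-] Hxy; exists k.
    (* An index at least 2 on either side gives a product member; if both indices are 1, the point
       is in [M 1 x N 1], hence in [K]. *)
    have [[//|[|i]] im Mx] := covM x; last first.
      by exists (M i.+2 `*` [set: G2]) => //; left; right; exists i.+2.
    have [[//|[|j]] jn Ny] := covN y; last first.
      by exists ([set: G1] `*` N j.+2) => //; right; exists j.+2.
    by exists K; [left; left|exact: diagonal_setX].
  - move=> [_|k].
      exists (x1, y1) => [|[//|j] /= jmn]; first exact: diagonal_setX.
      (* Membership elsewhere would equate an index at least 2 with the private index 1. *)
      by case: ifPn => jm [/= xM yN];
        [have := x1P j.+2 _ xM|have := y1P (j.+1 - m).+2 _ yN] => /=; lia.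
    rewrite /=; case: ifPn => km kmn.
      have [|x Mx xP] := privM k.+2; first by rewrite /=; lia.
      exists (x, y1) => // -[_ /=|j /= jmn].
        (* As [y1] is in [N 1], membership in [K] would put [x] in [M 1], against its privacy. *)
        by move=> /(diagonal_fst hM1 hN1 hap hbp)/(_ Ny1) /(xP 1%N D1m).
      by case: ifPn => jm [/= xM yN];
        [have := xP j.+2 _ xM|have := y1P (j.+1 - m).+2 _ yN] => /=; lia.
    have [|y Ny yP] := privN (k.+1 - m).+2; first by rewrite /=; lia.
    exists (x1, y) => // -[_ /=|j /= jmn].
      by move=> /(diagonal_snd hM1 hN1 hap hbp)/(_ Mx1) /(yP 1%N D1n).
    by case: ifPn => jm [/= xM yN];
      [have := x1P j.+2 _ xM|have := yP (j.+1 - m).+2 _ yN] => /=; lia.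
split=> //.
- apply/seteqP; split=> [[x y] Cxy|[x y] [/= Mx Ny]].
    have Mx i : (1 <= i <= m)%N -> i <> 1%N -> M i x.
      by move=> im i1; have [] : (M i `*` [set: G2]) (x, y);
        [apply: Cxy; left; right; exists i => //=; lia|].
    have Ny j : (1 <= j <= n)%N -> j <> 1%N -> N j y.
      by move=> jn j1; have [] : ([set: G1] `*` N j) (x, y);
        [apply: Cxy; right; exists j => //=; lia|].
    (* The members of index at least 2 already meet inside the first one, on each side, by
       irredundance. *)
    split=> /= [i im|j jn].
      have [->|/eqP/(Mx _ im)//] := eqVneq i 1%N.
      by apply: (bigcap_cover_delete _ covM D1m Mx1 x1P) => // k /propM[].
    have [->|/eqP/(Ny _ jn)//] := eqVneq j 1%N.
    by apply: (bigcap_cover_delete _ covN D1n Ny1 y1P) => // k /propN[].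
  move=> _ [[->|[i /= im <-]]|[j /= jn <-]].
  - by apply: diagonal_setX; [exact: Mx|exact: Ny].
  - by split=> //; apply: Mx => /=; lia.
  - by split=> //; apply: Ny => /=; lia.
- move=> [_ maxM] [_ maxN]; split; first by case: irrC => -[].
  have max1 : maximal_subgroup (M 1%N) by apply: maxM; exists 1%N.
  have max2 : maximal_subgroup (N 1%N) by apply: maxN; exists 1%N.
  move=> _ [[->|[i /= im <-]]|[j /= jn <-]].
  - exact: diagonal_maximal hap hbp _ _ _.
  - by apply/setXT_maximal/maxM; exists i => //=; lia.
  - by apply/setTX_maximal/maxN; exists j => //=; lia.
Qed.
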